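(* Let $Z$ be a random variable with values in $\{0,1,2,\dots\}$ and finite mean $\lambda=\mathbb{E}Z>0$. Let $p\in[0,1]$ and let $(U_i)_{i\ge 1}$ be a sequence of independent random variables, independent of $Z$, with $\mathbb{P}(U_i=1)=1-\mathbb{P}(U_i=0)=p$ for every $i$. Define $$X=\sum_{i=1}^{Z}U_i,\qquad Y=\sum_{i=1}^{Z}(1-U_i).$$ Then $Z$ has a Poisson distribution if and only if $X$ and $Y$ are independent.
   Context: Empty sums (when $Z=0$) are equal to $0$. ''Independent of $Z$'' means that the whole sequence $(U_i)_{i\ge1}$ is independent of $Z$.
   Formalization: The direction ''X and Y independent implies Z Poisson'' is proved only for 0 < p < 1, since it is false at p = 0 and p = 1 (e.g. Z = 1 constant, p = 0: X = 0 a.s. is independent of Y); the other direction is proved for all p in [0,1]. *)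

(* Defs.v *)
From HB Require Import structures.
From mathcomp Require Import all_boot all_order all_algebra.
From mathcomp Require Import all_classical all_reals all_analysis.

Set Implicit Arguments.
Unset Strict Implicit.
Unset Printing Implicit Defensive.

Import Order.TTheory GRing.Theory Num.Theory.

Local Open Scope classical_set_scope.
Local Open Scope ring_scope.

Section independence.
Context {d : measure_display} {T : measurableType d} {R : realType}.
Variable P : probability T R.

Definition indep_systems (F G : set (set T)) : Prop :=
  forall A B, F A -> G B -> P (A `&` B) = (P A * P B)%E.

(* the sigma-algebra generated by one map; measurability of the map is not
   built in *)
Definition sigma_of d' (T' : measurableType d') (X : T -> T') : set (set T) :=
  preimage_set_system setT X measurable.

Definition sigma_of_family (I : Type) d' (T' : measurableType d')
    (X : I -> T -> T') : set (set T) :=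
  <<s \bigcup_i sigma_of (X i) >>.

Definition indep_rv d1 d2 (T1 : measurableType d1) (T2 : measurableType d2)
    (X : T -> T1) (Y : T -> T2) : Prop :=
  indep_systems (sigma_of X) (sigma_of Y).

(* the whole family X, as one object, is independent of Y *)
Definition indep_family_rv (I : Type) d1 d2 (T1 : measurableType d1)
    (T2 : measurableType d2) (X : I -> T -> T1) (Y : T -> T2) : Prop :=
  indep_systems (sigma_of_family X) (sigma_of Y).

Definition mutually_indep (I : eqType) d' (T' : measurableType d')
    (X : I -> T -> T') : Prop :=
  forall (s : seq I) (B : I -> set T'), uniq s ->
    (forall i, measurable (B i)) ->
    P (\bigcap_(i in [set` s]) (X i @^-1` B i)) =
    (\prod_(i <- s) P (X i @^-1` B i))%E.

(* poisson_pmf is the genuine Poisson mass function only for a positive rate *)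
Definition poisson_distributed (Z : T -> nat) : Prop :=
  exists2 mu : R, 0 < mu &
    forall k : nat, P (Z @^-1` [set k]) = (poisson_pmf mu k)%:E.

End independence.

(* the summands V_1, V_2, ... are indexed from 0, as V 0, V 1, ... *)
Definition random_sum {T : Type} {R : realType}
    (Z : T -> nat) (V : nat -> T -> R) (t : T) : R :=
  \sum_(i < Z t) V i t.

(* Main.v *)
(* Since X + Y = Z, the event {X = j, Y = k} is {Z = j + k} intersected with
   {U_1 + ... + U_(j+k) = j}, so with q n = P(Z = n)
     P(X = j, Y = k) = q (j + k) C(j + k, j) p^j (1 - p)^k.
   For a Poisson q the right-hand side is a product a_j b_k, which for a
   probability on pairs of naturals is independence.  Conversely, if it equals
   f j * g k, comparing the pairs (1, n) and (0, n) gives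
   q (n + 1) (n + 1) p f 0 = q n f 1, so q n = q 0 mu^n / n! with
   mu = f 1 / (p f 0).  The mean of Z being positive serves only to exclude
   q = (1, 0, 0, ...). *)
Require Import Defs.
From HB Require Import structures.
From mathcomp Require Import all_boot all_order all_algebra.
From mathcomp Require Import all_classical all_reals all_analysis.
From mathcomp Require Import ring measurable_realfun.

Set Implicit Arguments.
Unset Strict Implicit.
Unset Printing Implicit Defensive.

Import Order.TTheory GRing.Theory Num.Theory.

Local Open Scope classical_set_scope.
Local Open Scope ring_scope.

(** * Events and partitions up to null sets *)

Section full_measure.
Context {d : measure_display} {T : measurableType d} {R : realType}.
Variable P : probability T R.

Lemma probability_setI_full (E W : set T) :
  measurable E -> measurable W -> P W = 1%E -> P (E `&` W) = P E.
Proof.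
move=> mE mW PW; rewrite [RHS](measureDI P mE mW).
have PWC : P (~` W) = 0%E by rewrite probability_setC// PW subee.
rewrite [X in (X + _)%E](_ : _ = 0%E) ?add0e//.
apply: (subset_measure0 (B := ~` W)) => //.
- exact: measurableD.
- exact: measurableC.
Qed.

Lemma probability_bigcap_full (F : nat -> set T) :
  (forall i, measurable (F i)) -> (forall i, P (F i) = 1%E) ->
  P (\bigcap_i F i) = 1%E.
Proof.
move=> mF PF.
have mI : measurable (\bigcap_i F i).
  by apply: bigcap_measurable => // i _; exact: mF.
have PFC i : P (~` F i) = 0%E by rewrite probability_setC// PF subee.
have : P (~` \bigcap_i F i) = 0%E.
  apply: measure_negligible; first exact: measurableC.
  rewrite setC_bigcap; apply: negligible_bigcup => i.
  by exists (~` F i); split => //; [exact: measurableC|exact: PFC].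
rewrite probability_setC//.
rewrite -(fineK (fin_num_measure P _ mI)) -EFinB => -[/eqP].
by rewrite subr_eq0 => /eqP <-.
Qed.

(** The cells need to cover only up to a null set: the level sets of a random sum at the naturals
    have no better covering, since each [U i] is 0 or 1 only almost surely. *)
Lemma probability_countable_partition (C : nat -> set T) (E : set T) :
  (forall i, measurable (C i)) -> trivIset setT C -> P (\bigcup_i C i) = 1%E ->
  measurable E -> (P E = \sum_(0 <= i <oo) P (E `&` C i))%E.
Proof.
move=> mC tC PC mE.
have mCE i : measurable (E `&` C i) by exact: measurableI.
rewrite -(probability_setI_full mE _ PC); last exact: bigcup_measurable.
rewrite setI_bigcupr measure_semi_bigcup//; last exact: bigcup_measurable.
exact: trivIset_setIl.
Qed.

(** Covering is expressed by masses adding up to 1, the form in which a binomial expansion delivers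
    it. *)
Lemma probability_finite_partition (I : finType) (C : I -> set T) (E : set T) :
  (forall i, measurable (C i)) -> trivIset setT C ->
  (\sum_i P (C i) = 1)%E ->
  measurable E -> (P E = \sum_i P (E `&` C i))%E.
Proof.
move=> mC tC PC mE.
have sumP (F : I -> set T) : (forall i, measurable (F i)) -> trivIset setT F ->
    (P (\bigcup_i F i) = \sum_i P (F i))%E.
  move=> mF tF; rewrite (measure_fin_bigcup _ finite_finset)//.
  rewrite [RHS]fsbig_seq ?index_enum_uniq//.
  by apply: eq_fsbigl; apply/seteqP; split => i //= _; rewrite mem_index_enum.
rewrite -(probability_setI_full mE _ (etrans (sumP _ mC tC) PC)); last first.
  by apply: fin_bigcup_measurable => [|i _]; [exact: finite_finset|exact: mC].
rewrite setI_bigcupr sumP// => [i|]; first exact: measurableI.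
exact: trivIset_setIl.
Qed.

End full_measure.

(** * Independence of almost surely natural-valued variables *)

Section discrete_independence.
Context {d : measure_display} {T : measurableType d} {R : realType}.
Variable P : probability T R.
Local Open Scope ereal_scope.

(* Stating the product form as a cross-product identity avoids normalising the
   factors: summing over j' and k' turns it into the conclusion. *)
Lemma indep_of_cross_products (C D : nat -> set T) :
  (forall j, measurable (C j)) -> trivIset setT C -> P (\bigcup_j C j) = 1 ->
  (forall k, measurable (D k)) -> trivIset setT D -> P (\bigcup_k D k) = 1 ->
  (forall j k j' k', P (C j `&` D k) * P (C j' `&` D k') =
                     P (C j `&` D k') * P (C j' `&` D k)) ->
  forall j k, P (C j `&` D k) = P (C j) * P (D k).
Proof.
move=> mC tC PC mD tD PD cross j k.
have mCD i l : measurable (C i `&` D l) by exact: measurableI.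
have sumC (E : set T) : measurable E -> P E = \sum_(0 <= i <oo) P (C i `&` E).
  move=> mE; rewrite (probability_countable_partition mC tC PC mE).
  by apply: eq_eseriesr => i _; rewrite setIC.
have sumD := probability_countable_partition mD tD PD.
have scale (E : set T) (F : nat -> set T) : measurable E ->
    P E * (\sum_(0 <= i <oo) P (F i)) = \sum_(0 <= i <oo) P E * P (F i).
  move=> mE; rewrite -(fineK (fin_num_measure P _ mE)) nneseriesZl//.
(* The right-hand side becomes a double sum over [k'] and [j']; [cross] pulls out [P (C j]&[D k)],
   which no longer depends on either index, and the remaining masses add up to 1. *)
rewrite muleC [in RHS](sumD (C j))// scale//.
under eq_eseriesr => k' _.
  rewrite muleC (sumC (D k))// scale//.
  under eq_eseriesr => j' _ do rewrite cross.
  rewrite -scale// -(sumC (D k'))//.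
  over.
rewrite -scale//.
have -> : \sum_(0 <= i <oo) P (D i) = 1.
  by rewrite -measure_semi_bigcup//; exact: bigcup_measurable.
by rewrite mule1.
Qed.

Lemma trivIset_preimage_natr (X : T -> R) :
  trivIset setT (fun k : nat => X @^-1` [set k%:R%R]).
Proof.
by apply/trivIsetP => i j _ _ ij; apply/seteqP; split => // t [/= ->] /eqP;
  rewrite eqr_nat (negbTE ij).
Qed.

Lemma indep_preimage_natr (Y : T -> R) (F : set T) (B : set R) :
  measurable_fun setT Y -> P (\bigcup_k Y @^-1` [set k%:R%R]) = 1 ->
  measurable F -> measurable B ->
  (forall k : nat, P (F `&` Y @^-1` [set k%:R%R]) =
                   P F * P (Y @^-1` [set k%:R%R])) ->
  P (F `&` Y @^-1` B) = P F * P (Y @^-1` B).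
Proof.
move=> mY PY mF mB ind.
have mYB (A : set R) : measurable A -> measurable (Y @^-1` A).
  by move=> mA; rewrite -[_ @^-1` _]setTI; exact: mY.
have sumY := probability_countable_partition
  (fun k => mYB _ (measurable_set1 k%:R%R))
  (@trivIset_preimage_natr Y) PY.
rewrite sumY; last by apply: measurableI => //; exact: mYB.
rewrite [in RHS](sumY (Y @^-1` B)); last exact: mYB.
rewrite -(fineK (fin_num_measure P _ mF)) -nneseriesZl//.
apply: eq_eseriesr => k _; rewrite (fineK (fin_num_measure P _ mF)).
rewrite -setIA -preimage_setI.
have [kB|kB] := pselect (B k%:R%R).
  suff -> : B `&` [set k%:R%R] = [set k%:R%R] by exact: ind.
  by apply/seteqP; split => [x []//|x /= ->].
suff -> : B `&` [set k%:R%R] = set0.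
  by rewrite preimage_set0 setI0 measure0 mule0.
by apply/seteqP; split => // x [/[swap] /= ->].
Qed.

Lemma indep_rv_natr (X Y : T -> R) :
  measurable_fun setT X -> P (\bigcup_j X @^-1` [set j%:R%R]) = 1 ->
  measurable_fun setT Y -> P (\bigcup_k Y @^-1` [set k%:R%R]) = 1 ->
  (forall j k : nat, P (X @^-1` [set j%:R%R] `&` Y @^-1` [set k%:R%R]) =
     P (X @^-1` [set j%:R%R]) * P (Y @^-1` [set k%:R%R])) ->
  indep_rv P X Y.
Proof.
move=> mX PX mY PY ind _ _ [A mA <-] [B mB <-]; rewrite !setTI.
have mXA (A' : set R) : measurable A' -> measurable (X @^-1` A').
  by move=> mA'; rewrite -[_ @^-1` _]setTI; exact: mX.
have mYB (A' : set R) : measurable A' -> measurable (Y @^-1` A').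
  by move=> mA'; rewrite -[_ @^-1` _]setTI; exact: mY.
(* Points are replaced by Borel sets one variable at a time: first for [Y] with the event on [X]
   fixed, then for [X] with [Y] held at the value [k]. *)
apply: indep_preimage_natr => // [|k]; first exact: mXA.
rewrite setIC muleC; apply: indep_preimage_natr => // [|j]; first exact: mYB.
by rewrite setIC muleC ind.
Qed.

End discrete_independence.

(** The algebra of the converse, with [r] in the role of 1 - p. Eliminating [g n] between the pairs
    (0, n) and (1, n) gives a one-step recurrence for [q]; the constant [q 0] is left to be fixed by
    normalisation. *)
Lemma factorial_recurrence (R : numFieldType) (q f g : nat -> R) (p r : R) :
  0 < p -> r != 0 -> (forall j, 0 <= f j) ->
  (forall j k, q (j + k)%N * ('C(j + k, j)%:R * p ^+ j * r ^+ k) = f j * g k) ->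
  (exists n, q n.+1 != 0) ->
  exists2 mu : R, 0 < mu & forall n, q n = q 0%N * (mu ^+ n * n`!%:R^-1).
Proof.
move=> p_gt0 r0 f_ge0 qfg [m qm].
have p0 := lt0r_neq0 p_gt0.
(* A nonzero [q m.+1] makes every product on the antidiagonal of m + 1 nonzero. As m + 1 is at least
   1, this antidiagonal contains both (0, m + 1) and (1, m), hence [f 0] and [f 1] are nonzero. *)
have fgN0 j k : (j + k)%N = m.+1 -> f j != 0 /\ g k != 0.
  move=> jk; apply/andP; rewrite -negb_or -mulf_eq0 -qfg jk !mulf_eq0 !negb_or.
  by rewrite qm !expf_neq0// pnatr_eq0 -lt0n bin_gt0 -jk leq_addr.
have [f00 _] := fgN0 0%N m.+1 erefl.
have [f10 _] := fgN0 1%N m erefl.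
exists (f 1%N / (f 0%N * p)).
  by rewrite divr_gt0// ?mulr_gt0// lt0r ?f00 ?f10 f_ge0.
elim=> [|n IHn]; first by rewrite expr0 fact0 invr1 !mulr1.
have q0n : q n = f 0%N * g n / r ^+ n.
  have := qfg 0%N n; rewrite add0n bin0 expr0 !mul1r => <-.
  by rewrite mulfK// expf_neq0.
have q1n : q n.+1 * (n.+1%:R * p * r ^+ n) = f 1%N * g n.
  by have := qfg 1%N n; rewrite add1n bin1 expr1.
rewrite exprS factS natrM.
rewrite (_ : _ * _ = q n * (f 1%N / (f 0%N * p) / n.+1%:R)); last first.
  by set mu := f 1%N / _; rewrite [in RHS]IHn invfM; ring.
(* This factor is the coefficient of [q n.+1] in [q1n]; after multiplication both sides are
   multiples of [g n]. *)
apply: (mulIf (x := n.+1%:R * p * r ^+ n)).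
  by rewrite !mulf_neq0// ?pnatr_eq0// expf_neq0.
rewrite q1n q0n; field.
by rewrite expf_neq0// p0 f00 nat1r pnatr_eq0.
Qed.

(** * The binomial law *)

Section bernoulli_sums.
Context {d : measure_display} {T : measurableType d} {R : realType}.
Variable P : probability T R.

(** Partition by the set of successful trials: the mass of an outcome depends only on the number of
    successes. For [j] above [n] both sides vanish through the binomial coefficient, so the
    truncated exponent [n - j] is harmless. *)
Lemma bernoulli_sum_law (U : nat -> {RV P >-> R}) (p : R) :
  mutually_indep P (fun i => U i : T -> R) ->
  (forall i, P (U i @^-1` [set 1]) = p%:E) ->
  (forall i, P (U i @^-1` [set 0]) = (1 - p)%:E) ->
  forall n j, P ((fun t => \sum_(i < n) U i t) @^-1` [set j%:R]) =
    ('C(n, j)%:R * p ^+ j * (1 - p) ^+ (n - j))%:E.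
Proof.
move=> indU U1 U0 n j.
(* [O A] is the event that, among the first [n] trials, exactly those in [A] give 1 and the others
   give 0. [A] is mapped into the naturals because [indU] speaks of lists of natural indices. *)
pose O (A : {set 'I_n}) := \bigcap_(i in [set` iota 0 n])
  U i @^-1` [set (i \in [seq val x | x in A])%:R].
have memA (A : {set 'I_n}) (i : 'I_n) :
    (nat_of_ord i \in [seq val x | x in A]) = (i \in A).
  exact: (fintype.mem_image val_inj).
have OE A t : O A t <-> forall i : 'I_n, U i t = (i \in A)%:R.
  split=> [OAt i|UA i /=].
    by rewrite -memA; apply: OAt; rewrite /= mem_iota add0n ltn_ord.
  rewrite mem_iota add0n => /= lt_in.
  by rewrite -[i]/(nat_of_ord (Ordinal lt_in)) memA; exact: UA.
have prodE (A : {set 'I_n}) : \prod_(i < n) (if i \in A then p else 1 - p) =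
    p ^+ #|A| * (1 - p) ^+ (n - #|A|).
  rewrite big_if/= !prodr_const; congr (_ * _ ^+ _).
  exact: (canRL (addKn _) (etrans (cardC A) (card_ord n))).
have mU i (B : set R) : measurable B -> measurable (U i @^-1` B).
  by move=> mB; rewrite -[_ @^-1` _]setTI; exact: measurable_funP.
have mO A : measurable (O A).
  by apply: fin_bigcap_measurable => // i _; exact: mU.
have PO (A : {set 'I_n}) : P (O A) = (p ^+ #|A| * (1 - p) ^+ (n - #|A|))%:E.
  rewrite /O (indU _ (fun i => [set (i \in [seq val x | x in A])%:R]))//;
    last first.
    exact: iota_uniq.
  rewrite (_ : iota 0 n = index_iota 0 n) ?big_mkord; last first.
    by rewrite /index_iota subn0.
  under eq_bigr => i _.
    rewrite memA (_ : P _ = (if i \in A then p else 1 - p)%:E); last first.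
      by case: (i \in A); rewrite ?U1 ?U0.
    over.
  by rewrite prodEFin prodE.
have tO : trivIset setT O.
  move=> A B _ _ [t [/OE At /OE Bt]]; apply/setP => i.
  have /eqP := etrans (esym (At i)) (Bt i).
  by rewrite eqr_nat; case: (i \in A); case: (i \in B).
(* Expanding the product of [n] factors p + (1 - p) over subsets gives total mass 1, so other values
   of the [U i] are negligible. *)
have sumO : (\sum_A P (O A) = 1)%E.
  under eq_bigr do rewrite PO.
  rewrite sumEFin; congr EFin.
  transitivity (\prod_(i < n) (p + (1 - p))).
    by rewrite bigA_distr; apply: eq_bigr => A _; rewrite prodE.
  by rewrite prodr_const subrKC expr1n.
have mS : measurable ((fun t => \sum_(i < n) U i t) @^-1` [set j%:R : R]).
  by rewrite -[_ @^-1` _]setTI; exact: measurable_sum.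
rewrite (probability_finite_partition mO tO sumO mS).
(* Outcomes with a number of successes other than [j] miss the event; those with exactly [j] lie
   inside it, have equal mass, and are counted by [card_draws]. *)
rewrite (bigID (fun A : {set 'I_n} => #|A| == j))/=.
rewrite [X in (_ + X)%E]big1 ?adde0; last first.
  move=> A Aj; rewrite (_ : _ `&` _ = set0) ?measure0//.
  apply/seteqP; split => // t [/= St /OE At]; move: Aj; apply/negP/negPn.
  rewrite -(eqr_nat R) -St -sum1_card natr_sum big_mkcond/=; apply/eqP.
  by apply: eq_bigr => i _; rewrite At; case: (i \in A).
rewrite (eq_bigr (fun=> (p ^+ j * (1 - p) ^+ (n - j))%:E)); last first.
  move=> A /eqP Aj; rewrite setIidr ?PO ?Aj// => t /OE At /=.
  rewrite -Aj -sum1_card natr_sum [RHS]big_mkcond/=.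
  by apply: eq_bigr => i _; rewrite At; case: (i \in A).
rewrite sumEFin sumr_const; congr EFin.
rewrite -mulrA mulr_natl; congr (_ *+ _).
have := card_draws 'I_n j; rewrite card_ord => <-.
by apply: eq_card => A; rewrite !inE.
Qed.

End bernoulli_sums.

(** * Sums with a random number of terms, and the law of [Z] *)

Section random_sums.
Context {d : measure_display} {T : measurableType d} {R : realType}.
Variable P : probability T R.
Implicit Types (Z : {RV P >-> nat}) (U : nat -> {RV P >-> R}).

Lemma measurable_preimage_nat Z (A : set nat) : measurable (Z @^-1` A).
Proof. by rewrite -[_ @^-1` _]setTI; exact: measurable_funP. Qed.

Lemma measurable_random_sum Z (V : nat -> T -> R) :
  (forall i, measurable_fun setT (V i)) -> measurable_fun setT (random_sum Z V).
Proof.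
move=> mV _ A mA; rewrite setTI.
rewrite (_ : _ @^-1` _ = \bigcup_n
    (Z @^-1` [set n] `&` (fun t => \sum_(i < n) V i t) @^-1` A)).
  apply: bigcup_measurable => n _; apply: measurableI.
    exact: measurable_preimage_nat.
  rewrite -[X in measurable X]setTI.
  exact: (measurable_sum (index_enum 'I_n) (fun i => mV i)).
apply/seteqP; split => [t At|t [n _ [/= <-]]//]; by exists (Z t).
Qed.

(** Since [Z] may be unbounded, all the [V i] must be 0 or 1 simultaneously; this has probability 1
    as a countable intersection. There the sum is the number of ones. *)
Lemma random_sum_natr Z (V : nat -> T -> R) :
  (forall i, measurable_fun setT (V i)) ->
  (forall i, P (V i @^-1` [set 0; 1]) = 1%E) ->
  P (\bigcup_j random_sum Z V @^-1` [set j%:R]) = 1%E.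
Proof.
move=> mV V01.
have mX (B : set R) : measurable B -> measurable (random_sum Z V @^-1` B).
  by move=> mB; rewrite -[_ @^-1` _]setTI; exact: measurable_random_sum.
have mV01 i : measurable (V i @^-1` [set 0; 1]).
  by rewrite -[_ @^-1` _]setTI; apply: mV => //; exact: measurableU.
have mXj : measurable (\bigcup_j random_sum Z V @^-1` [set j%:R]).
  by apply: bigcup_measurable => j _; exact: mX.
apply/eqP; rewrite eq_le probability_le1//=.
rewrite -(probability_bigcap_full mV01 V01); apply: le_measure; rewrite ?inE.
- by apply: bigcap_measurable => // i _; exact: mV01.
- exact: mXj.
- move=> t Vt; exists (\sum_(i < Z t) (V i t == 1%R))%N => //=.
  rewrite natr_sum; apply: eq_bigr => i _.
  by have [->|->] := Vt i I; rewrite ?eqxx// eq_sym oner_eq0.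
Qed.

Lemma random_sum_joint_law Z U (p : R) :
  mutually_indep P (fun i => U i : T -> R) ->
  indep_family_rv P (fun i => U i : T -> R) Z ->
  (forall i, P (U i @^-1` [set 1]) = p%:E) ->
  (forall i, P (U i @^-1` [set 0]) = (1 - p)%:E) ->
  forall j k : nat,
    P (random_sum Z (fun i t => U i t) @^-1` [set j%:R] `&`
       random_sum Z (fun i t => 1 - U i t) @^-1` [set k%:R]) =
    (P (Z @^-1` [set (j + k)%N]) *
     ('C(j + k, j)%:R * p ^+ j * (1 - p) ^+ k)%:E)%E.
Proof.
move=> indU indUZ U1 U0 j k.
rewrite (_ : _ `&` _ = (fun t => \sum_(i < (j + k)%N) U i t) @^-1` [set j%:R]
    `&` Z @^-1` [set (j + k)%N]); last first.
  (* X + Y = Z holds at every point, whatever values the [U i] take, so the two events are equal and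
     not merely equal up to a null set. *)
  have YE t : random_sum Z (fun i t => 1 - U i t) t =
      (Z t)%:R - random_sum Z (fun i t => U i t) t.
    by rewrite /random_sum sumrB sumr_const card_ord.
  apply/seteqP; split => [t [/= Xj]|t [/= Sj Zt]].
    rewrite YE Xj => /eqP; rewrite subr_eq -natrD eqr_nat addnC => /eqP Zt.
    by rewrite -Zt.
  have Xj : random_sum Z (fun i t => U i t) t = j%:R by rewrite /random_sum Zt.
  by rewrite YE Xj Zt natrD addrAC subrr add0r.
rewrite indUZ.
- by rewrite (bernoulli_sum_law indU U1 U0) addKn muleC.
(* Independence from [Z] applies only to events of the sigma-algebra generated by the family [U], so
   measurability of the partial sum is checked for that sigma-algebra. *)
- have mU i : measurable_fun setT
      (U i : g_sigma_algebraType (\bigcup_i sigma_of (U i)) -> R).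
    by move=> _ B mB; apply: sub_sigma_algebra; exists i => //; exists B.
  rewrite /sigma_of_family -[_ @^-1` _]setTI.
  exact: (measurable_sum (index_enum 'I_(j + k)) (fun i => mU i)).
- by exists [set (j + k)%N] => //; rewrite setTI.
Qed.

(** Otherwise [Z] is almost surely 0, being positive only on a countable union of null events, and
    its mean is 0. *)
Lemma positive_mean_nonzero Z (lambda : R) :
  0 < lambda -> ('E_P[fun t => (Z t)%:R : R] = lambda%:E)%E ->
  exists n : nat, P (Z @^-1` [set n.+1]) != 0%E.
Proof.
move=> l0 EZ; apply: contrapT => /forallNP Z0.
suff : ('E_P[fun t => (Z t)%:R : R] = 0)%E.
  by rewrite EZ => -[] /eqP; rewrite gt_eqF.
rewrite unlock (@ae_eq_integral _ _ _ _ _ (cst 0%E))//.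
- by rewrite integral0.
- move=> _ B mB; rewrite setTI.
  exact: (measurable_preimage_nat Z [set n | B (n%:R)%:E]).
- apply: (@negligibleS _ _ _ _ (\bigcup_n Z @^-1` [set n.+1])).
    move=> t /= /not_implyP[_]; case Zt: (Z t) => [|n] // _; by exists n.
  apply: negligible_bigcup => n; exists (Z @^-1` [set n.+1]); split => //.
    exact: measurable_preimage_nat.
  by apply/eqP; apply: contrapT => /negP; exact: Z0.
Qed.

(** Both the law of [Z] and the Poisson law have total mass 1, which forces [c] to be exp(- mu). *)
Lemma poisson_distributed_of_form Z (c mu : R) : 0 < mu ->
  (forall n, P (Z @^-1` [set n]) = (c * (mu ^+ n * n`!%:R^-1))%:E) ->
  poisson_distributed P Z.
Proof.
move=> mu_gt0 PZ.
have PZE n : P (Z @^-1` [set n]) = ((c * expR mu)%:E * (poisson_pmf mu n)%:E)%E.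
  by rewrite PZ -EFinM /poisson_pmf mu_gt0 expRN; congr EFin; field;
    rewrite gt_eqF ?expR_gt0// pnatr_eq0 -lt0n fact_gt0.
(* The exponential series enters as the total mass of the Poisson measure [poisson_prob]. *)
have sum_pmf : (\sum_(0 <= n <oo) (poisson_pmf mu n)%:E = 1)%E.
  have := @probability_setT _ _ _ (poisson_prob mu 0).
  rewrite /= /poisson_prob mu_gt0 -nneseries_esumT// => n.
  by rewrite lee_fin poisson_pmf_ge0.
have sum_Z : (\sum_(0 <= n <oo) P (Z @^-1` [set n]) = 1)%E.
  rewrite -measure_semi_bigcup.
  - rewrite -(@probability_setT _ _ _ P); congr (P _).
    by apply/seteqP; split => // t _; exists (Z t).
  - by move=> n; exact: measurable_preimage_nat.
  - by apply/trivIsetP => i j _ _ ij; apply/seteqP; split => // t [/= ->] /eqP;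
      rewrite (negbTE ij).
  - by apply: bigcup_measurable => n _; exact: measurable_preimage_nat.
exists mu => // n; rewrite PZE.
suff -> : c * expR mu = 1 by rewrite mul1e.
move: sum_Z; under eq_eseriesr do rewrite PZE.
rewrite nneseriesZl ?sum_pmf ?mule1; first by case.
by move=> i _; rewrite lee_fin poisson_pmf_ge0.
Qed.

End random_sums.

(** For p = 0 or p = 1 one of the two sums is almost surely 0, hence independent of the other for
    every law of [Z]; the converse therefore assumes 0 < p < 1, while the forward implication covers
    the endpoints. *)
Theorem lemma1 (R : realType) (d : measure_display) (T : measurableType d)
    (P : probability T R)
    (Z : {RV P >-> nat}) (lambda : R)
    (lambda_gt0 : 0 < lambda)
    (mean_Z : ('E_P[fun t => (Z t)%:R : R] = lambda%:E)%E)
    (p : R) (p01 : 0 <= p <= 1)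
    (U : nat -> {RV P >-> R})
    (indep_U : mutually_indep P (fun i => U i : T -> R))
    (indep_UZ : indep_family_rv P (fun i => U i : T -> R) Z)
    (bernoulli_U : forall i, P (U i @^-1` [set 1]) = p%:E /\
                             (1 - P (U i @^-1` [set 0%R]) = p%:E)%E) :
  let X : T -> R := random_sum Z (fun i t => U i t) in
  let Y : T -> R := random_sum Z (fun i t => 1 - U i t) in
  (poisson_distributed P Z -> indep_rv P X Y) /\
  (0 < p < 1 -> indep_rv P X Y -> poisson_distributed P Z).
Proof.
move=> X Y.
have U1 i : P (U i @^-1` [set 1]) = p%:E by have [] := bernoulli_U i.
have mU (i : nat) (B : set R) : measurable B -> measurable (U i @^-1` B).
  by move=> mB; rewrite -[_ @^-1` _]setTI; exact: measurable_funP.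
have U0 i : P (U i @^-1` [set 0]) = (1 - p)%:E.
  have [_] := bernoulli_U i.
  have fin0 := fin_num_measure P _ (mU i _ (measurable_set1 0)).
  rewrite -(fineK fin0) -EFinB => -[<-].
  by rewrite subKr.
have U01 i : P (U i @^-1` [set 0; 1]) = 1%E.
  rewrite preimage_setU measureU; [|exact: mU|exact: mU|].
    by rewrite [X in (X + _)%E]U0 [X in (_ + X)%E]U1 -EFinD subrK.
  by apply/seteqP; split => // t [/= ->] /eqP; rewrite eq_sym oner_eq0.
have mV i : measurable_fun setT (fun t => 1 - U i t).
  by apply: measurable_funB => //; exact: measurable_funP.
have mX : measurable_fun setT X.
  by apply: measurable_random_sum => i; exact: measurable_funP.
have mY : measurable_fun setT Y by exact: measurable_random_sum.
have mXj (j : nat) : measurable (X @^-1` [set j%:R]).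
  by rewrite -[_ @^-1` _]setTI; exact: mX.
have mYk (k : nat) : measurable (Y @^-1` [set k%:R]).
  by rewrite -[_ @^-1` _]setTI; exact: mY.
have law := random_sum_joint_law indep_U indep_UZ U1 U0.
split=> [[mu mu_gt0 PZ]|/andP[p_gt0 p_lt1] indXY].
- have PX : P (\bigcup_j X @^-1` [set j%:R]) = 1%E.
    by apply: random_sum_natr => // i; exact: measurable_funP.
  have PY : P (\bigcup_k Y @^-1` [set k%:R]) = 1%E.
    apply: random_sum_natr => // i; rewrite -(U01 i); congr (P _).
    apply/seteqP; split => t [] /= e; rewrite /preimage /=.
    + by right; rewrite -(subKr 1 (U i t)) e subr0.
    + by left; rewrite -(subKr 1 (U i t)) e subrr.
    + by right; rewrite e subr0.
    + by left; rewrite e subrr.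
  (* The Poisson mass at j + k splits because C(j + k, j) j! k! = (j + k)!. The constant exp(- mu)
     need not be shared out between the factors: it appears squared on both sides of the cross
     products. *)
  have lawE j k : P (X @^-1` [set j%:R] `&` Y @^-1` [set k%:R]) =
      (expR (- mu) * ((mu * p) ^+ j / j`!%:R) *
       ((mu * (1 - p)) ^+ k / k`!%:R))%:E.
    rewrite [LHS]law PZ -EFinM /poisson_pmf mu_gt0; congr EFin.
    have /(congr1 (fun n => n%:R : R)) := bin_fact (leq_addr k j).
    rewrite addKn !natrM => <-.
    have fN0 n : n`!%:R != 0 :> R by rewrite pnatr_eq0 -lt0n fact_gt0.
    have bN0 : 'C(j + k, j)%:R != 0 :> R.
      by rewrite pnatr_eq0 -lt0n bin_gt0 leq_addr.
    rewrite exprD !exprMn; field.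
    by rewrite !fN0 bN0.
  apply: indep_rv_natr => //; apply: indep_of_cross_products => //.
  + exact: trivIset_preimage_natr.
  + exact: trivIset_preimage_natr.
  + by move=> j k j' k'; rewrite !lawE -!EFinM; congr EFin; ring.
- pose q n := fine (P (Z @^-1` [set n])).
  have qE n : P (Z @^-1` [set n]) = (q n)%:E.
    by rewrite fineK// fin_num_measure//; exact: measurable_preimage_nat.
  pose f j := fine (P (X @^-1` [set j%:R])).
  pose g k := fine (P (Y @^-1` [set k%:R])).
  have qfg (j k : nat) :
      q (j + k)%N * ('C(j + k, j)%:R * p ^+ j * (1 - p) ^+ k) = f j * g k.
    apply: EFin_inj; rewrite !EFinM -qE -!EFinM -law.
    rewrite EFinM /f /g !fineK ?fin_num_measure//.
    by apply: indXY; [exists [set j%:R]|exists [set k%:R]] => //; rewrite setTI.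
  have [n qn] : exists n, q n.+1 != 0.
    have [n Zn] := positive_mean_nonzero lambda_gt0 mean_Z.
    by exists n; move: Zn; rewrite qE.
  have [||j||mu mu_gt0 qmu] := factorial_recurrence _ _ _ qfg.
  + exact: p_gt0.
  + by rewrite subr_eq0 eq_sym lt_eqF.
  + exact: fine_ge0.
  + by exists n.
  (* The undetermined constant of the recurrence is [q 0]. *)
  apply: (@poisson_distributed_of_form _ _ _ _ _ (q 0%N) mu) => // k.
  by rewrite qE qmu.
Qed.
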